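(* Let $p\in(1,\infty)$ and, for each $m\in\mathbb{N}$, let $\psi_m^D$ be the Daubechies wavelet with $m$ vanishing moments, i.e. $\widehat{\psi_m^D}(\omega)=\frac{1}{\sqrt{2\pi}}H_m(\omega/2+\pi)\prod_{\ell=1}^\infty H_m(2^{-\ell-1}\omega)$. Then, as $m\to\infty$, $$\|\widehat{{}_m\psi_m^D}\|_p=C\cdot\frac{2^{1/p}}{\sqrt{2\pi}}\cdot\frac{2^{-m}\cdot A(m)}{(\sqrt{mp/2})^{1/p}}\cdot\left(1+\mathcal{O}(m^{-1/2})\right),$$ where $C$ is a positive constant independent of $m$ and $A(m)$ is a quantity satisfying $\sqrt{\frac{c_m}{2m}}\le A(m)\le\sqrt{\frac12}$.
   Context: The Fourier transform is $\widehat f(\omega)=\frac{1}{\sqrt{2\pi}}\int_{\mathbb{R}}f(x)e^{-i x\omega}\,dx$; $\|\cdot\|_p$ is the $L_p(\mathbb{R})$ norm. For an integer $k$, ${}_kf$ denotes the function with $\widehat{{}_kf}(\omega)=(i\omega)^{-k}\widehat f(\omega)$. $H_m$ is the Daubechies orthonormal low-pass mask of order $m$: a $2\pi$-periodic trigonometric polynomial $H_m(t)=\sum_{\nu=0}^L h_\nu e^{-i\nu t}$ with $$|H_m(t)|^2=1-c_m\int_0^t\sin^{2m-1}\omega\,d\omega,\qquad c_m=\left(\int_0^\pi\sin^{2m-1}\omega\,d\omega\right)^{-1}$$ (equivalently $|H_m(t)|^2=\cos^{2m}(t/2)\sum_{\nu=0}^{m-1}\binom{m-1+\nu}{\nu}\sin^{2\nu}(t/2)$),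 normalized by $H_m(0)=1$ so that the infinite product converges. *)

(* Defs.v *)
From HB Require Import structures.
From mathcomp Require Import all_boot all_order all_algebra.
From mathcomp Require Import all_classical all_reals all_analysis.
From mathcomp Require Import complex.

Set Implicit Arguments.
Unset Strict Implicit.
Unset Printing Implicit Defensive.

Import Order.TTheory GRing.Theory Num.Theory.
Import numFieldNormedType.Exports.

Local Open Scope classical_set_scope.
Local Open Scope ring_scope.
Local Open Scope complex_scope.

(* exp(ix) *)
Definition expi {R : realType} (x : R) : R[i] := cos x +i* sin x.

(* The modulus as an element of R: the generic norm `|z| is R[i]-valued. *)
Definition cmod {R : realType} (z : R[i]) : R := Normc.normc z.

Definition cintegrable {R : realType} (f : R -> R[i]) : Prop :=
  (@lebesgue_measure R).-integrable setT (EFin \o (fun x => complex.Re (f x))) /\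
  (@lebesgue_measure R).-integrable setT (EFin \o (fun x => complex.Im (f x))).

Definition cintegral {R : realType} (f : R -> R[i]) : R[i] :=
  Rintegral (@lebesgue_measure R) setT (fun x => complex.Re (f x)) +i*
  Rintegral (@lebesgue_measure R) setT (fun x => complex.Im (f x)).

Definition fourier {R : realType} (f : R -> R[i]) (w : R) : R[i] :=
  ((Num.sqrt (2 * pi))^-1)%:C * cintegral (fun x => f x * expi (- (x * w))).

(* g is the function {}_k f. Fourier transforms are continuous, and at w = 0
   the factor (iw)^(-k) is undefined when k > 0, so w = 0 is left out. *)
Definition is_fourier_primitive {R : realType} (k : int) (f g : R -> R[i]) :
    Prop :=
  cintegrable g /\
  forall w : R, w != 0 -> fourier g w = ('i * w%:C) ^ (- k) * fourier f w.

(* The oriented integral from a to b. *)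
Definition oint {R : realType} (a b : R) (f : R -> R) : R :=
  if a <= b then Rintegral (@lebesgue_measure R) `[a, b] f
  else - Rintegral (@lebesgue_measure R) `[b, a] f.

Definition daub_c (R : realType) (m : nat) : R :=
  (oint 0 pi (fun w => sin w ^+ (2 * m).-1))^-1.

Definition trig_polynomial {R : realType} (H : R -> R[i]) : Prop :=
  exists (L : nat) (h : nat -> R[i]), forall t,
    H t = \sum_(0 <= nu < L.+1) h nu * expi (- (nu%:R * t)).

(* The modulus determines H only up to the choice of a spectral factor; every
   choice is allowed. *)
Definition daubechies_mask {R : realType} (m : nat) (H : R -> R[i]) : Prop :=
  [/\ trig_polynomial H,
      forall t, cmod (H t) ^+ 2 =
        1 - daub_c R m * oint 0 t (fun w => sin w ^+ (2 * m).-1)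
    & H 0 = 1].

(* The product of the u l over l >= 1. *)
Definition infprod {R : realType} (u : nat -> R[i]) : R[i] :=
  limn (fun n => \prod_(1 <= l < n.+1) u l : R[i]^o).

Definition daubechies_wavelet {R : realType} (H psi : R -> R[i]) : Prop :=
  cintegrable psi /\
  forall w : R, fourier psi w =
    ((Num.sqrt (2 * pi))^-1)%:C * H (w / 2 + pi) *
    infprod (fun l => H (2 ^- l.+1 * w)).

(* Main.v *)
(** Let [N] be the norm and [K = 2^(1/p)/sqrt(2 pi) * 2^-m / sqrt(mp/2)^(1/p)].
    The quantity [A] may range between orders [m^(-1/4)] and [1], so it suffices
    to bound [N] on both sides: [N >= C K sqrt(c_m/(2m))] and [N = o(K)]; then
    [A := N/(C K)] is admissible for large [m], with zero error term.

    With [I x] the integral of [sin^(2m-1)] over [[0, x]], the identity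
    [I (x + pi) = I pi - I x] gives [|H(w/2 + pi)|^2 = c_m I(w/2)], and
    [sin^(2m) x/(2m) <= I x <= 3 sin^(2m) x/(2m)] on [[0, 11/10]]. Hence near
    [0] the transform behaves as [2^-m sqrt(c_m/(2m)) (sin x/x)^m] with
    [x = w/2]. This is of order [2^-m sqrt(c_m/(2m))] for [w <= 1/sqrt m], which
    yields the lower bound. For the upper bound [(sin x/x)^m <= 1/(1 + m x^2/32)],
    and for [x > 11/10] the factor [x^-m] alone is exponentially small, so that
    [2^-m eps/(1 + m w^2/128)] with [eps] tending to [0] dominates everywhere. *)
Require Import Defs.
From mathcomp Require Import all_boot all_order all_algebra.
From mathcomp Require Import all_classical all_reals all_analysis.
From mathcomp Require Import complex.
From mathcomp Require Import ring lra.
From mathcomp Require Import measurable_realfun.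
Import Order.TTheory GRing.Theory Num.Theory.
Import numFieldNormedType.Exports.
Local Open Scope classical_set_scope.
Local Open Scope ring_scope.
Local Open Scope complex_scope.

(** * Elementary inequalities for sine, cosine and powers *)

Lemma is_derive_continuous {R : realType} (f df : R -> R) :
  (forall x : R, is_derive x 1 f (df x)) -> continuous f.
Proof.
move=> dfE x; apply: differentiable_continuous.
by apply/derivable1_diffP; exact: ex_derive.
Qed.

(** Mean value theorem. Many comparisons below apply it to the difference of the two sides; the
    derivative is given on the whole line, so continuity on the segment comes for free. *)
Lemma is_derive_ge0_le {R : realType} (f df : R -> R) (a b : R) :
  a <= b -> (forall x : R, is_derive x 1 f (df x)) ->
  (forall x, a <= x <= b -> 0 <= df x) -> f a <= f b.
Proof.
move=> ab dfE df0.
have [|x + /eqP] := @MVT_segment R f df a b ab (fun x _ => dfE x).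
  by apply: continuous_subspaceT; exact: is_derive_continuous dfE.
rewrite in_itv/= => xab; rewrite subr_eq => /eqP ->.
by rewrite lerDr mulr_ge0 ?df0 ?subr_ge0.
Qed.

Lemma sin_le_id {R : realType} (x : R) : 0 <= x -> sin x <= x.
Proof.
move=> x0; rewrite -subr_ge0.
have := @is_derive_ge0_le R (fun y => y - sin y) (fun y => 1 - cos y) 0 x x0.
by rewrite sin0 subrr; apply => y _; rewrite subr_ge0 cos_le1.
Qed.

Lemma norm_sin_le {R : realType} (x : R) : `|sin x| <= `|x|.
Proof.
wlog x0 : x / 0 <= x => [h|].
  have [/h//|/ltW x0] := leP 0 x.
  by rewrite -normrN -sinN -(normrN x) h// oppr_ge0.
rewrite (ger0_norm x0) ler_norml sin_le_id// andbT.
rewrite lerNl -sinN.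
have := @is_derive_ge0_le R (fun y => y - sin (- y)) (fun y => 1 + cos (- y)) 0 x x0.
rewrite oppr0 sin0 subrr subr_ge0; apply => [y|y _].
  by apply: is_derive_eq; rewrite /GRing.scale/=; lra.
by rewrite -lerBlDl sub0r cos_geN1.
Qed.

Lemma cos_ge_quadratic {R : realType} (x : R) : 1 - x ^+ 2 / 2 <= cos x.
Proof.
wlog x0 : x / 0 <= x => [h|].
  have [/h//|/ltW x0] := leP 0 x.
  by rewrite -cosN -sqrrN h// oppr_ge0.
have := @is_derive_ge0_le R (fun y => cos y - (1 - y ^+ 2 / 2)) (fun y => y - sin y) 0 x x0.
rewrite cos0 expr0n/= mul0r subr0 subrr subr_ge0; apply => [y|y /andP[y0 _]].
  by apply: is_derive_eq; rewrite /GRing.scale/=; lra.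
by rewrite subr_ge0 sin_le_id.
Qed.

Lemma sin_ge_mul_cos {R : realType} (x : R) : 0 <= x <= pi -> x * cos x <= sin x.
Proof.
move=> /andP[x0 xpi].
have := @is_derive_ge0_le R (fun y => sin y - y * cos y) (fun y => y * sin y) 0 x x0.
rewrite sin0 mul0r subrr subr_ge0; apply => [y|y /andP[y0 yx]].
  by apply: is_derive_eq; rewrite /GRing.scale/=; lra.
by rewrite mulr_ge0// sin_ge0_pi// y0 (le_trans yx).
Qed.

Lemma sin_ge_cubic {R : realType} (x : R) :
  0 <= x <= pi -> x * (1 - x ^+ 2 / 2) <= sin x.
Proof.
move=> x0; apply: le_trans (sin_ge_mul_cos x x0).
by apply: ler_wpM2l (cos_ge_quadratic x); case/andP: x0.
Qed.

(** Since [cos (x / 2) = 1 - 2 sin^2 (x/4) <= 1 - x^2/32], the duplication formula gives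
    [sin x <= x (1 - x^2/32)], and [(1 - u)(1 + u) <= 1]. The product form is ready to be raised to
    the power [m]. *)
Lemma sin_mul_le {R : realType} (x : R) :
  0 <= x <= 11 / 10 -> sin x * (1 + x ^+ 2 / 32) <= x.
Proof.
move=> /andP[x0 x1]; have pi2 := pi_ge2 R.
have sE : sin x = 2 * (cos (x / 2) * sin (x / 2)).
  by rewrite [x in LHS]splitr -mulr2n sin_mulr2n mulr_natl.
have cE : cos (x / 2) = 1 - 2 * sin (x / 4) ^+ 2.
  have -> : x / 2 = (x / 4) *+ 2 by lra.
  by rewrite cos_mulr2n cos2sin2; lra.
have s4 : x / 8 <= sin (x / 4).
  apply: le_trans (sin_ge_cubic _ _); last by lra.
  by nra.
have c2 : cos (x / 2) <= 1 - x ^+ 2 / 32 by rewrite cE; nra.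
have s2 : sin (x / 2) <= x / 2 by rewrite sin_le_id//; lra.
have s20 : 0 <= sin (x / 2) by rewrite sin_ge0_pi//; lra.
have c20 : 0 <= cos (x / 2) by rewrite cos_ge0_pihalf//; lra.
have : sin x <= x * (1 - x ^+ 2 / 32).
  rewrite sE; apply: (@le_trans _ _ (2 * ((1 - x ^+ 2 / 32) * (x / 2)))); last lra.
  by rewrite ler_pM2l// ler_pM.
move=> h; apply: (@le_trans _ _ (x * (1 - x ^+ 2 / 32) * (1 + x ^+ 2 / 32))).
  by rewrite ler_wpM2r//; nra.
rewrite -mulrA ler_piMr//; nra.
Qed.

(** This is the quadratic term of the binomial expansion; the induction has to carry the constant
    and linear terms too. It makes [x ^+ m] outgrow [m x^2] for [x > 11/10]. *)
Lemma quadratic_le_exp {R : realType} (y : R) (m : nat) : 0 <= y ->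
  m%:R * (m%:R - 1) / 2 * y ^+ 2 <= (1 + y) ^+ m.
Proof.
move=> y0; suff h : 1 + m%:R * y + m%:R * (m%:R - 1) / 2 * y ^+ 2 <= (1 + y) ^+ m.
  by apply: le_trans h; rewrite lerDr addr_ge0// mulr_ge0.
elim: m => [|m ih]; first by rewrite expr0; lra.
rewrite (exprS _ m); apply: (@le_trans _ _ ((1 + y) *
   (1 + m%:R * y + m%:R * (m%:R - 1) / 2 * y ^+ 2))); last first.
  by rewrite ler_wpM2l// addr_ge0.
have : (0 : R) <= m%:R * (m%:R - 1).
  case: m {ih} => [|m]; first by rewrite mul0r.
  by rewrite mulr_ge0// subr_ge0 ler1n.
move=> h; have : 0 <= m%:R * (m%:R - 1) / 2 * (y * y * y).
  by apply: mulr_ge0; rewrite ?divr_ge0// !mulr_ge0.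
rewrite -(natr1 m); lra.
Qed.

Lemma bernoulli_le {R : realType} (x : R) (m : nat) : -1 <= x ->
  1 + m%:R * x <= (1 + x) ^+ m.
Proof.
move=> x1; elim: m => [|m ih]; first by rewrite expr0; lra.
rewrite (exprS _ m); apply: (@le_trans _ _ ((1 + x) * (1 + m%:R * x))); last first.
  by rewrite ler_wpM2l//; lra.
have : (0 : R) <= m%:R * (x * x) by rewrite mulr_ge0// -expr2 sqr_ge0.
rewrite -(natr1 m); lra.
Qed.

(** * Integrals of odd powers of the sine *)

Lemma poly_primitive {R : numFieldType} (P : {poly R}) :
  exists Q : {poly R}, Q^`() = P.
Proof.
(* At [i = 0] the division by zero returns [0]; differentiation discards this coefficient. *)
exists (\poly_(i < (size P).+1) (P`_i.-1 / i%:R)).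
apply/polyP => i; rewrite coef_deriv coef_poly ltnS.
case: ltnP => [_|Pi]; last by rewrite mul0rn nth_default.
by rewrite -[LHS]mulr_natr mulfVK// pnatr_eq0.
Qed.

Lemma is_derive_horner {R : realType} (P : {poly R}) (x : R) :
  is_derive x 1 (horner P) P^`().[x].
Proof.
apply: DeriveDef; first exact: derivable_horner.
by rewrite derivE derive1E.
Qed.

Lemma oint_primitive {R : realType} (f F : R -> R) (a b : R) :
  continuous f -> (forall x : R, is_derive x 1 F (f x)) ->
  oint a b f = F b - F a.
Proof.
move=> cf dF.
have FTC (c d : R) : c < d -> Rintegral lebesgue_measure `[c, d] f = F d - F c.
  move=> cd; rewrite /Rintegral (@continuous_FTC2 _ f F)//.
  - exact: continuous_subspaceT.
  - have cF := is_derive_continuous F f dF.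
    split; first by move=> x _; exact: ex_derive.
    + by apply: cvg_at_right_filter; exact: cF.
    + by apply: cvg_at_left_filter; exact: cF.
  - by move=> x _; rewrite derive1E; exact: derive_val.
rewrite /oint; case: (ltgtP a b) => [/FTC//|/FTC ->|->].
  by rewrite opprB.
by rewrite set_itv1 Rintegral_set1 subrr.
Qed.

(** Substitution [u = cos w] in [(1 - cos^2 w)^n sin w]. The form in [cos t] covers both
    orientations at once and makes evenness immediate. *)
Lemma oint0_sin_odd {R : realType} (n : nat) : exists Q : {poly R},
  Q^`() = (1 - 'X^2) ^+ n /\
  forall t, oint 0 t (fun w : R => sin w ^+ n.*2.+1) = Q.[1] - Q.[cos t].
Proof.
have [Q QE] := poly_primitive ((1 - 'X^2) ^+ n : {poly R}).
have dF (x : R) : is_derive x 1 (fun y => - Q.[cos y]) (sin x ^+ n.*2.+1).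
  have dQ := is_derive_horner Q (cos x).
  have dc : is_derive x 1 (cos : R -> R) (- sin x) by exact: is_derive_cos.
  have dQc := @is_derive1_comp R (horner Q) cos x _ _ dQ dc.
  have := is_deriveN dQc; move=> dN; apply: (@is_derive_eq _ _ _ _ _ _ _ _ dN).
  by rewrite QE mulrN opprK !hornerE -sin2cos2 -exprM mul2n -exprSr.
exists Q; split => // t; have cf : continuous (fun x : R => sin x ^+ n.*2.+1).
  move=> x; apply: (@continuous_comp _ _ _ sin (fun y : R => y ^+ n.*2.+1)).
    exact: continuous_sin.
  exact: exprn_continuous.
by rewrite (oint_primitive _ _ 0 t cf dF) cos0 opprK addrC.
Qed.

(** The function [I] of the opening comment for [m = n.+1]: the exponent [2m - 1] is [n.*2.+1], free
    of truncated subtraction. *)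
Definition sinint {R : realType} (n : nat) (t : R) : R :=
  oint 0 t (fun w => sin w ^+ n.*2.+1).

Lemma is_derive_sinint {R : realType} (n : nat) (t : R) :
  is_derive t 1 (sinint n) (sin t ^+ n.*2.+1).
Proof.
have [Q [QE IE]] := @oint0_sin_odd R n.
have dQ := is_derive_horner Q (cos t).
have dc : is_derive t 1 (cos : R -> R) (- sin t) by exact: is_derive_cos.
have dN := is_deriveB (is_derive_cst Q.[1] t 1)
  (@is_derive1_comp R (horner Q) cos t _ _ dQ dc).
have -> : sinint n = cst Q.[1] - (horner Q \o cos).
  by apply/funext => x; rewrite /sinint IE.
apply: (@is_derive_eq _ _ _ _ _ _ _ _ dN).
by rewrite QE sub0r mulrN opprK !hornerE -sin2cos2 -exprM mul2n -exprSr.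
Qed.

Lemma sinint0 {R : realType} (n : nat) : sinint n (0 : R) = 0.
Proof.
have [Q [_ IE]] := @oint0_sin_odd R n.
by rewrite /sinint IE cos0 subrr.
Qed.

Lemma sinintN {R : realType} (n : nat) (t : R) : sinint n (- t) = sinint n t.
Proof.
have [Q [_ IE]] := @oint0_sin_odd R n.
by rewrite /sinint !IE cosN.
Qed.

(** [Q] is nondecreasing on [[-1, 1]], where its derivative [(1 - x^2)^n] is nonnegative, so
    [Q.[cos t] <= Q.[1]] for every real [t]. *)
Lemma sinint_ge0 {R : realType} (n : nat) (t : R) : 0 <= sinint n t.
Proof.
have [Q [QE IE]] := @oint0_sin_odd R n.
rewrite /sinint IE subr_ge0.
apply: (@is_derive_ge0_le R _ (fun x => Q^`().[x])) => [|x /andP[cx x1]].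
- exact: cos_le1.
- rewrite QE !hornerE exprn_ge0// subr_ge0.
  have := cos_geN1 t; nra.
Qed.

(** The exponent being odd, the two terms of [g] have opposite derivatives; the constant [g] is
    evaluated at [0]. *)
Lemma sinintDpi {R : realType} (n : nat) (t : R) :
  sinint n (t + pi) = sinint n pi - sinint n t.
Proof.
pose g (x : R) := sinint n (x + pi) + sinint n x.
have dg (x : R) : is_derive x 1 g 0.
  have dx : is_derive x 1 (fun y : R => y + pi) 1.
    by apply: is_derive_eq; rewrite addr0.
  have dN := is_deriveD
    (@is_derive1_comp R (sinint n) (fun y => y + pi) x _ _ (is_derive_sinint n (x + pi)) dx)
    (is_derive_sinint n x).
  apply: (@is_derive_eq _ _ _ _ _ _ _ _ dN).
  by rewrite sinDpi mulr1 exprNn -signr_odd /= odd_double/= mulN1r addNr.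
have := is_derive_0_is_cst t 0 dg.
by rewrite /g add0r sinint0 addr0 => <-; rewrite addrK.
Qed.

Lemma is_derive_exprS_div {R : realType} (f : R -> R) (n : nat) (x df : R) :
  is_derive x 1 f df ->
  is_derive x 1 (fun y => f y ^+ n.+1 / n.+1%:R) (f x ^+ n * df).
Proof.
move=> dfx; have dN := is_deriveZ n.+1%:R^-1 (@is_deriveX _ _ f n.+1 x 1 df dfx).
have -> : (fun y => f y ^+ n.+1 / n.+1%:R) = n.+1%:R^-1 \*: f ^+ n.+1.
  by apply/funext => y /=; rewrite fctE mulrC.
apply: (@is_derive_eq _ _ _ _ _ _ _ _ dN).
by rewrite /GRing.scale/= -mulrA mulKf// pnatr_eq0.
Qed.

Lemma is_derive_sin_pow {R : realType} (n : nat) (x : R) :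
  is_derive x 1 (fun y => sin y ^+ n.*2.+2 / n.*2.+2%:R)
    (sin x ^+ n.*2.+1 * cos x).
Proof. exact: is_derive_exprS_div (is_derive_sin x). Qed.

(** Comparison of derivatives: [sin^(2m-1) cos <= sin^(2m-1)] on [[0, pi]]. *)
Lemma sinint_ge_sin_pow {R : realType} (n : nat) (x : R) : 0 <= x <= pi ->
  sin x ^+ n.*2.+2 / n.*2.+2%:R <= sinint n x.
Proof.
move=> /andP[x0 xpi].
have := @is_derive_ge0_le R
  (fun y => sinint n y - sin y ^+ n.*2.+2 / n.*2.+2%:R)
  (fun y => sin y ^+ n.*2.+1 - sin y ^+ n.*2.+1 * cos y) 0 x x0.
rewrite sinint0 sin0 expr0n/= mul0r subrr subr_ge0; apply => [y|y /andP[y0 yx]].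
  exact: is_deriveB (is_derive_sinint n y) (is_derive_sin_pow n y).
rewrite subr_ge0 ler_piMr ?cos_le1// exprn_ge0// sin_ge0_pi//.
by rewrite y0 (le_trans yx).
Qed.

(** The constants fit together: [cos y >= 1 - y^2/2 >= 1/3] on [[0, 11/10]], so three times the
    derivative of [sin^(2m)/(2m)] dominates [sin^(2m-1)]. *)
Lemma sinint_le_sin_pow {R : realType} (n : nat) (x : R) : 0 <= x <= 11 / 10 ->
  sinint n x <= 3 * (sin x ^+ n.*2.+2 / n.*2.+2%:R).
Proof.
move=> /andP[x0 xpi].
have := @is_derive_ge0_le R
  (fun y => 3 * (sin y ^+ n.*2.+2 / n.*2.+2%:R) - sinint n y)
  (fun y => 3 * (sin y ^+ n.*2.+1 * cos y) - sin y ^+ n.*2.+1) 0 x x0.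
rewrite sinint0 sin0 expr0n/= mul0r mulr0 subrr subr_ge0; apply => [y|y /andP[y0 yx]].
  exact: is_deriveB (is_deriveZ 3 (is_derive_sin_pow n y)) (is_derive_sinint n y).
rewrite subr_ge0 mulrCA ler_peMr//.
  have pi2 := pi_ge2 R; rewrite exprn_ge0// sin_ge0_pi//.
  by rewrite y0; lra.
have := cos_ge_quadratic y; nra.
Qed.

Lemma sinint_le_pow {R : realType} (n : nat) (x : R) : 0 <= x ->
  sinint n x <= x ^+ n.*2.+2 / n.*2.+2%:R.
Proof.
move=> x0.
have := @is_derive_ge0_le R
  (fun y => y ^+ n.*2.+2 / n.*2.+2%:R - sinint n y)
  (fun y => y ^+ n.*2.+1 - sin y ^+ n.*2.+1) 0 x x0.
rewrite sinint0 expr0n/= mul0r subrr subr_ge0; apply => [y|y /andP[y0 yx]].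
  apply: is_deriveB (is_derive_sinint n y).
  rewrite -[y ^+ _]mulr1; exact: (@is_derive_exprS_div R id).
rewrite subr_ge0 (le_trans (ler_norm _))// normrX lerXn2r ?nnegrE//.
by rewrite -{2}(ger0_norm y0) norm_sin_le.
Qed.

Lemma sinint_pi {R : realType} (n : nat) :
  sinint n (pi : R) = 2 * sinint n (pi / 2 : R).
Proof.
have := @sinintDpi R n (- (pi / 2)).
have -> : - (pi / 2) + pi = pi / 2 :> R by lra.
by rewrite sinintN => h; lra.
Qed.

(** The lower bound at [pi / 2], doubled. It yields [c_m <= m], hence
    [sqrt (c_m/(2m)) <= sqrt (1/2)]: the interval prescribed for [A] is nonempty. *)
Lemma sinint_pi_ge_inv {R : realType} (n : nat) :
  n.+1%:R^-1 <= sinint n (pi : R).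
Proof.
have := @sinint_ge_sin_pow R n (pi / 2).
have := pi_ge2 R => pi2.
rewrite sin_pihalf expr1n -doubleS -muln2 natrM sinint_pi => h.
have : 1 / (n.+1%:R * 2) <= sinint n (pi / 2 : R) by apply: h; lra.
by rewrite div1r invfM; set u : R := n.+1%:R^-1; set v : R := sinint _ _; lra.
Qed.

Lemma sinint_pi_gt0 {R : realType} (n : nat) : 0 < sinint n (pi : R).
Proof. by apply: lt_le_trans (sinint_pi_ge_inv n); rewrite invr_gt0. Qed.

(** Only the window of width [d = 1/sqrt (2m)] to the left of [pi / 2] is kept: there
    [sin^(2m-1) >= (1 - d^2/2)^(2m-1) >= 1/2] by Bernoulli, and symmetry doubles the resulting
    [d/2]. Hence [c_m <= sqrt (2m)] and [c_m/(2m)] tends to [0], the source of [N = o(K)]. *)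
Lemma sinint_pi_ge_sqrt {R : realType} (n : nat) :
  (Num.sqrt n.*2.+2%:R)^-1 <= sinint n (pi : R).
Proof.
set d : R := (_)^-1.
have pi2 := pi_ge2 R.
have d0 : 0 < d by rewrite invr_gt0 sqrtr_gt0 ltr0n.
have dE : d ^+ 2 * n.*2.+2%:R = 1.
  by rewrite exprVn sqr_sqrtr ?ler0n// mulVf.
have d1 : d <= 1.
  rewrite invf_le1 ?sqrtr_gt0 ?ltr0n// -[leLHS]sqrtr1.
  by rewrite ler_wsqrtr// (ler_nat R 1).
rewrite sinint_pi.
have dI : pi / 2 - d <= pi / 2 by lra.
have [|x] := @MVT_segment R (sinint n) (fun x => sin x ^+ n.*2.+1) _ _ dI
    (fun x _ => is_derive_sinint n x).
  by apply: continuous_subspaceT; exact: is_derive_continuous (is_derive_sinint n).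
rewrite in_itv/= => /andP[x1 x2].
have -> : pi / 2 - (pi / 2 - d) = d by lra.
have Ipd := @sinint_ge0 R n (pi / 2 - d).
suff : 1 / 2 <= sin x ^+ n.*2.+1.
  by move=> h /eqP; rewrite subr_eq => /eqP ->; nra.
have sx : 1 + (- (d ^+ 2 / 2)) <= sin x.
  have -> : sin x = cos (x - pi / 2) by rewrite cosBpihalf.
  apply: le_trans (cos_ge_quadratic _); nra.
apply: (@le_trans _ _ ((1 + - (d ^+ 2 / 2)) ^+ n.*2.+1)); last first.
  by rewrite lerXn2r// ?nnegrE; nra.
apply: le_trans (bernoulli_le _ _ _); last by nra.
have : n.*2.+1%:R * d ^+ 2 <= n.*2.+2%:R * d ^+ 2.
  by rewrite ler_wpM2r ?sqr_ge0// ler_nat.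
lra.
Qed.

(** * The complex modulus and convergence of infinite products *)

Lemma normE {R : realType} (z : R[i]) : `|z| = (cmod z)%:C.
Proof. by case: z. Qed.

Lemma cmod_ge0 {R : realType} (z : R[i]) : 0 <= cmod z.
Proof. by case: z => a b; exact: sqrtr_ge0. Qed.

Lemma cmodM {R : realType} (z w : R[i]) : cmod (z * w) = cmod z * cmod w.
Proof. exact: Normc.normcM. Qed.

Lemma cmodR {R : realType} (x : R) : cmod x%:C = `|x|.
Proof. by rewrite /cmod/= expr0n/= addr0 sqrtr_sqr. Qed.

Lemma cmodD {R : realType} (z w : R[i]) : cmod (z + w) <= cmod z + cmod w.
Proof. exact: le_normcD. Qed.

Lemma cmodX {R : realType} (z : R[i]) (n : nat) : cmod (z ^+ n) = cmod z ^+ n.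
Proof.
elim: n => [|n ih]; first by rewrite !expr0; exact: Normc.normc1.
by rewrite !exprS cmodM ih.
Qed.

Lemma cmod_sum_le {R : realType} (n : nat) (u : nat -> R[i]) :
  cmod (\sum_(0 <= k < n) u k) <= \sum_(0 <= k < n) cmod (u k).
Proof.
elim: n => [|n ih]; first by rewrite !big_geq// /cmod/= expr0n/= addr0 sqrtr0.
by rewrite !big_nat_recr//= (le_trans (cmodD _ _))// lerD2r.
Qed.

Lemma norm_Re_le {R : realType} (z : R[i]) : `|complex.Re z| <= cmod z.
Proof.
by case: z => a b; rewrite /cmod/= -sqrtr_sqr ler_wsqrtr// lerDl sqr_ge0.
Qed.

Lemma norm_Im_le {R : realType} (z : R[i]) : `|complex.Im z| <= cmod z.
Proof.
by case: z => a b; rewrite /cmod/= -sqrtr_sqr ler_wsqrtr// lerDr sqr_ge0.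
Qed.

Lemma cmod_le_ReIm {R : realType} (z : R[i]) :
  cmod z <= `|complex.Re z| + `|complex.Im z|.
Proof.
case: z => a b; rewrite /cmod/= -[leRHS]ger0_norm ?addr_ge0// -sqrtr_sqr.
rewrite ler_wsqrtr// sqrrD !real_normK ?num_real//.
by rewrite addrAC lerDl mulrn_wge0// mulr_ge0.
Qed.

(** The real and imaginary parts of [exp(-ikt) - 1] are each at most [k |t|] in absolute value,
    whence the factor [2 k]. This makes the factors of the infinite product approach [1]
    geometrically. *)
Lemma trig_polynomial_lipschitz0 {R : realType} (H : R -> R[i]) :
  trig_polynomial H ->
  exists K : R, 0 <= K /\ forall t, cmod (H t - H 0) <= K * `|t|.
Proof.
move=> [L [h HE]].
exists (\sum_(0 <= k < L.+1) cmod (h k) * (2 * k%:R)); split.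
  by apply: sumr_ge0 => k _; rewrite mulr_ge0 ?cmod_ge0// mulr_ge0.
move=> t; rewrite !HE -sumrB (le_trans (cmod_sum_le _ _))// mulr_suml.
apply: ler_sum => k _; rewrite mulr0 oppr0 -mulrBr cmodM -mulrA.
rewrite ler_wpM2l ?cmod_ge0// (le_trans (cmod_le_ReIm _))//.
rewrite /expi cos0 sin0 /= oppr0 addr0 sinN cosN normrN.
set s := k%:R * t.
have -> : 2 * k%:R * `|t| = `|s| + `|s| by rewrite normrM ger0_norm//; lra.
apply: lerD; last exact: norm_sin_le.
rewrite distrC ger0_norm ?subr_ge0 ?cos_le1//.
(* [1 - cos s <= |s|] follows from [s^2/2 <= |s|] when [|s| <= 2], and from [1 - cos s <= 2]
   otherwise. *)
have c1 := cos_ge_quadratic s; have c2 := cos_geN1 s.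
have := normr_ge0 s; have [s1|s1] := leP `|s| 2; last lra.
have : s ^+ 2 = `|s| ^+ 2 by rewrite real_normK// num_real.
nra.
Qed.

Lemma cvg_Re_Im {R : realType} (u : nat -> R[i]) (a b : R) :
  (fun n => complex.Re (u n)) @ \oo --> a ->
  (fun n => complex.Im (u n)) @ \oo --> b ->
  (u : nat -> R[i]^o) @ \oo --> (a +i* b : R[i]^o).
Proof.
(* The order of [R[i]] compares only numbers with equal imaginary parts, so a positive tolerance is
   real. *)
move=> ca cb; apply/cvgrPdist_lt => -[e f]; rewrite ltcE/= => /andP[/eqP f0 e0].
have e2 : 0 < e / 2 by rewrite divr_gt0.
move/cvgrPdist_lt : ca => /(_ _ e2) ca; move/cvgrPdist_lt : cb => /(_ _ e2) cb.
near=> n; rewrite normE ltcE/= f0 eqxx/=.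
apply: (le_lt_trans (cmod_le_ReIm _)).
have : `|a - complex.Re (u n)| < e / 2 by near: n.
have : `|b - complex.Im (u n)| < e / 2 by near: n.
by case: (u n) => x y /=; lra.
Unshelve. all: by end_near. Qed.

Lemma cvg_cmod {R : realType} (u : nat -> R[i]) (l : R[i]) :
  (u : nat -> R[i]^o) @ \oo --> (l : R[i]^o) ->
  (fun n => cmod (u n)) @ \oo --> cmod l.
Proof.
move=> cu; apply/cvgrPdist_lt => e e0.
have : (0 : R[i]) < e%:C by rewrite ltcE/= eqxx.
move/cvgrPdist_lt : cu => /[apply] cu; near=> n.
have : `|l - u n| < e%:C by near: n.
rewrite normE ltcE/= eqxx/=; apply: le_lt_trans.
have h1 := cmodD (l - u n) (u n); have h2 := cmodD (u n - l) l.
have h3 : cmod (u n - l) = cmod (l - u n).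
  by rewrite -opprB /cmod; exact: normcN.
rewrite !subrK in h1 h2; rewrite ler_norml; lra.
Unshelve. all: by end_near. Qed.

(** The telescoping series of the increments is dominated by a geometric one, hence converges
    absolutely. *)
Lemma cvg_geometric_increments {R : realType} (x : nat -> R) (K : R) :
  (forall n, `|x n.+1 - x n| <= K * 2^-1 ^+ n) -> cvgn x.
Proof.
move=> dx.
have K0 : 0 <= K by have := dx 0; rewrite expr0 mulr1; apply: le_trans.
have h : cvgn (series (telescope x)).
  apply: normed_cvg; apply: (@series_le_cvg _ _ (geometric K 2^-1)) => //=.
  - by move=> n; rewrite mulr_ge0// exprn_ge0.
  - by apply: is_cvg_geometric_series; rewrite ger0_norm; lra.
rewrite telescopeK in h; have := is_cvgD h (is_cvg_cst (x 0)).
rewrite (_ : _ + _ = x); first exact.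
by apply/funext => n; rewrite fctE/= subrK.
Qed.

(** [infprod] is a [limn], informative only once the partial products converge. These stay in the
    unit disc, so consecutive ones differ by at most [cmod (u n.+1 - 1)], which decays
    geometrically. *)
Lemma cvg_cmod_infprod {R : realType} (u : nat -> R[i]) (K : R) :
  (forall l, cmod (u l) <= 1) -> (forall l, cmod (u l - 1) <= K * 2^-1 ^+ l) ->
  (fun n => \prod_(1 <= l < n.+1) cmod (u l)) @ \oo --> cmod (infprod u).
Proof.
move=> u1 uK; set P := fun n => \prod_(1 <= l < n.+1) u l.
have PE n : cmod (P n) = \prod_(1 <= l < n.+1) cmod (u l).
  rewrite /P; elim: n => [|n ih]; first by rewrite !big_geq//; exact: Normc.normc1.
  by rewrite !(big_nat_recr n.+1)//= cmodM ih.
have P1 n : cmod (P n) <= 1.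
  by rewrite PE; apply: prodr_ile1 => l _; rewrite cmod_ge0/=.
have dP n : cmod (P n.+1 - P n) <= K / 2 * 2^-1 ^+ n.
  have -> : P n.+1 - P n = P n * (u n.+1 - 1).
    by rewrite /P (big_nat_recr n.+1)//= mulrBr mulr1.
  rewrite cmodM -mulrA -exprS (le_trans _ (uK n.+1))// ler_piMl ?cmod_ge0//.
have ReB (z w : R[i]) : complex.Re z - complex.Re w = complex.Re (z - w).
  by case: z w => ? ? [].
have ImB (z w : R[i]) : complex.Im z - complex.Im w = complex.Im (z - w).
  by case: z w => ? ? [].
have cRe : cvgn (fun n => complex.Re (P n)).
  apply: (@cvg_geometric_increments _ _ (K / 2)) => n.
  by rewrite ReB (le_trans (norm_Re_le _)).
have cIm : cvgn (fun n => complex.Im (P n)).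
  apply: (@cvg_geometric_increments _ _ (K / 2)) => n.
  by rewrite ImB (le_trans (norm_Im_le _)).
have cP := cvg_Re_Im P _ _ cRe cIm.
have -> : (fun n => \prod_(1 <= l < n.+1) cmod (u l)) = (fun n => cmod (P n)).
  by apply/funext => n; rewrite PE.
apply: cvg_cmod; rewrite /infprod -/P.
exact: (cvgP _ cP).
Qed.

(** * The Daubechies mask and its infinite product *)

Lemma daub_cE {R : realType} (n : nat) : daub_c R n.+1 = (sinint n pi)^-1.
Proof. by rewrite /daub_c mul2n. Qed.

Lemma daub_c_gt0 {R : realType} (n : nat) : 0 < daub_c R n.+1.
Proof. by rewrite daub_cE invr_gt0 sinint_pi_gt0. Qed.

Lemma daub_c_le {R : realType} (n : nat) : daub_c R n.+1 <= n.+1%:R.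
Proof.
rewrite daub_cE -[leRHS]invrK lef_pV2 ?posrE ?invr_gt0 ?sinint_pi_gt0//.
exact: sinint_pi_ge_inv.
Qed.

Lemma daub_c_le_sqrt {R : realType} (n : nat) :
  daub_c R n.+1 <= Num.sqrt n.*2.+2%:R.
Proof.
rewrite daub_cE -[leRHS]invrK lef_pV2 ?posrE ?invr_gt0 ?sinint_pi_gt0 ?sqrtr_gt0//.
exact: sinint_pi_ge_sqrt.
Qed.

Lemma mask_sqr {R : realType} (n : nat) (H : R -> R[i]) (t : R) :
  daubechies_mask n.+1 H -> cmod (H t) ^+ 2 = 1 - daub_c R n.+1 * sinint n t.
Proof. by move=> [_ -> _]; rewrite mul2n. Qed.

Lemma mask_le1 {R : realType} (n : nat) (H : R -> R[i]) (t : R) :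
  daubechies_mask n.+1 H -> cmod (H t) <= 1.
Proof.
move=> /(mask_sqr n H t) Ht; rewrite -(@expr_le1 _ 2) ?cmod_ge0// Ht.
by rewrite gerBl mulr_ge0 ?sinint_ge0// ltW// daub_c_gt0.
Qed.

(** [c_m I(pi) = 1] by definition of [c_m]. The absolute value, allowed by evenness, reduces later
    estimates to nonnegative arguments. *)
Lemma mask_sqrDpi {R : realType} (n : nat) (H : R -> R[i]) (t : R) :
  daubechies_mask n.+1 H ->
  cmod (H (t + pi)) ^+ 2 = daub_c R n.+1 * sinint n `|t|.
Proof.
move=> /(mask_sqr n H (t + pi)) ->; rewrite sinintDpi mulrBr.
rewrite {1}daub_cE mulVf ?gt_eqF ?sinint_pi_gt0// opprB addrC subrK.
by have [//|_] := ger0P t; rewrite sinintN.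
Qed.

Lemma cvg_mask_infprod {R : realType} (n : nat) (H : R -> R[i]) (w : R) :
  daubechies_mask n.+1 H ->
  (fun N => \prod_(1 <= l < N.+1) cmod (H (2 ^- l.+1 * w))) @ \oo -->
  cmod (infprod (fun l => H (2 ^- l.+1 * w))).
Proof.
move=> dH; have [/trig_polynomial_lipschitz0[K [K0 HK]] _ H0] := dH.
apply: (@cvg_cmod_infprod _ _ (K * `|w|)) => l; first exact: mask_le1 dH.
rewrite -H0 (le_trans (HK _))// -mulrA ler_wpM2l// normrM mulrC.
rewrite ler_wpM2l// ger0_norm ?invr_ge0 ?exprn_ge0// exprVn.
by rewrite lef_pV2 ?posrE ?exprn_gt0// ler_eXn2l ?ltr1n.
Qed.

Lemma mask_infprod_le1 {R : realType} (n : nat) (H : R -> R[i]) (w : R) :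
  daubechies_mask n.+1 H -> cmod (infprod (fun l => H (2 ^- l.+1 * w))) <= 1.
Proof.
move=> dH; apply: (cvgr_to_le (cvg_mask_infprod n H w dH)); near=> N.
apply: prodr_ile1 => l _; rewrite cmod_ge0/=; exact: mask_le1 dH.
Unshelve. all: by end_near. Qed.

(** The bound is uniform in [m]: for [0 <= t <= 1], [c_m <= m] and [I t <= t^(2m)/(2m)] give
    [|H t|^2 >= 1 - t^2/2], and [|H t| >= |H t|^2] because [|H t| <= 1]. *)
Lemma mask_infprod_ge {R : realType} (n : nat) (H : R -> R[i]) (w : R) :
  daubechies_mask n.+1 H -> 0 <= w <= 1 ->
  3 / 4 <= cmod (infprod (fun l => H (2 ^- l.+1 * w))).
Proof.
move=> dH /andP[w0 w1].
apply: (cvgr_to_ge (cvg_mask_infprod n H w dH)); near=> N.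
have Hge l : 1 - 2 ^- l / 4 <= cmod (H (2 ^- l.+1 * w)).
  set t := 2 ^- l.+1 * w; set q : R := 2 ^- l.
  have q0 : 0 <= q by rewrite invr_ge0 exprn_ge0.
  have q1 : q <= 1 by rewrite invf_le1 ?exprn_gt0// exprn_ege1// ler1n.
  have tE : t = q / 2 * w by rewrite /t exprSr invfM.
  have t0 : 0 <= t by rewrite tE; nra.
  have tq : t <= q / 2 by rewrite tE; nra.
  have c0 := @daub_c_gt0 R n; have cn := @daub_c_le R n.
  have n0 : (0 : R) < n.+1%:R by rewrite ltr0n.
  have tt : t ^+ n.*2.+2 <= t ^+ 2 by rewrite ler_wiXn2l//; lra.
  have St : daub_c R n.+1 * sinint n t <= t ^+ 2 / 2.
    apply: (@le_trans _ _ (n.+1%:R * (t ^+ n.*2.+2 / n.*2.+2%:R))).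
      by apply: ler_pM; rewrite ?sinint_ge0 ?sinint_le_pow// ltW.
    have -> : n.*2.+2%:R = n.+1%:R * 2 :> R by rewrite -natrM muln2 doubleS.
    by rewrite invfM mulrCA mulVKf ?gt_eqF// ler_wpM2r.
  have := mask_sqr n H t dH.
  have := mask_le1 n H t dH; have := cmod_ge0 (H t); nra.
(* The extra [2 ^- N / 4] lets the induction close: it supplies the missing [1/4] at [N = 0], and
   the step with [q = 2 ^- M.+1] comes down to [q <= 1 / 2]. *)
suff : 3 / 4 + 2 ^- N / 4 <= \prod_(1 <= l < N.+1) cmod (H (2 ^- l.+1 * w)).
  by apply: le_trans; rewrite lerDl divr_ge0// invr_ge0 exprn_ge0.
elim: {+}N => [|M ih]; first by rewrite big_geq// expr0; lra.
rewrite big_nat_recr//=; move: (Hge M.+1); set q : R := 2 ^- M.+1.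
have qE : 2 ^- M = 2 * q by rewrite /q exprS invfM mulrA mulfV ?mul1r.
have q1 : q <= 1 / 2.
  rewrite /q exprS invfM; have : (2 ^+ M)^-1 <= 1 :> R.
    by rewrite invf_le1 ?exprn_gt0// exprn_ege1// ler1n.
  lra.
have q0 : 0 <= q by rewrite invr_ge0 exprn_ge0.
rewrite qE in ih => hM; have h : 0 <= 1 - q / 4 by lra.
apply: (@le_trans _ _ ((3 / 4 + 2 * q / 4) * (1 - q / 4))); first nra.
by apply: ler_pM => //; lra.
Unshelve. all: by end_near. Qed.

(** * Pointwise bounds for the transform *)

Lemma cmod_fourier_primitive {R : realType} (m : nat) (H psi g : R -> R[i])
    (w : R) : daubechies_wavelet H psi -> is_fourier_primitive m%:Z psi g ->
  w != 0 -> cmod (fourier g w) = `|w| ^- m * (Num.sqrt (2 * pi))^-1 *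
    (cmod (H (w / 2 + pi)) * cmod (infprod (fun l => H (2 ^- l.+1 * w)))).
Proof.
move=> [_ psiE] [_ gE] w0; rewrite gE// psiE !cmodM cmodR.
rewrite ger0_norm ?invr_ge0 ?sqrtr_ge0//.
have -> : cmod (('i * w%:C) ^ (- m%:Z)) = `|w| ^- m.
  rewrite -invr_expz -exprnP /cmod Normc.normcV -/(cmod _) cmodX cmodM cmodR.
  have -> : cmod ('i : R[i]) = 1 by rewrite /cmod/= expr0n/= expr1n add0r sqrtr1.
  by rewrite mul1r.
by rewrite !mulrA.
Qed.

Lemma sqrt2pi_ge1 {R : realType} : 1 <= Num.sqrt (2 * pi) :> R.
Proof.
by rewrite -[leLHS]sqrtr1 ler_wsqrtr//; have := pi_ge2 R; lra.
Qed.

(** The first summand of the coefficient serves [|w / 2| <= 11/10], the second larger arguments. The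
    hypothesis [0 < n] gives [m >= 2], hence [m (m - 1)/2 >= m^2/4]. *)
Lemma fourier_primitive_ub {R : realType} (n : nat) (H psi g : R -> R[i])
    (w : R) : (0 < n)%N -> daubechies_mask n.+1 H ->
  daubechies_wavelet H psi -> is_fourier_primitive n.+1%:Z psi g -> w != 0 ->
  cmod (fourier g w) <= 2 ^- n.+1 *
    (Num.sqrt (3 * daub_c R n.+1 / n.*2.+2%:R) + 2 * 22 ^+ 2 / n.+1%:R) /
    (1 + n.+1%:R * w ^+ 2 / 128).
Proof.
move=> n0 dH dpsi dg w0; rewrite (cmod_fourier_primitive n.+1 H psi g w dpsi dg w0).
set m := n.+1; set c := daub_c _ _; set P := cmod (infprod _).
have c0 : 0 < c := daub_c_gt0 n.
have P1 : P <= 1 := mask_infprod_le1 n H w dH.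
have P0 : 0 <= P := cmod_ge0 _.
set h := cmod (H _).
have h0 : 0 <= h := cmod_ge0 _.
have hE : h ^+ 2 = c * sinint n `|w / 2| := mask_sqrDpi n H (w / 2) dH.
have h1 : h <= 1 := mask_le1 n H _ dH.
pose x : R := `|w / 2|; rewrite -/x in hE.
have x0 : 0 < x by rewrite normr_gt0 mulf_neq0// invr_neq0.
have wE : `|w| = 2 * x by rewrite /x normrM (@ger0_norm _ 2^-1)//; lra.
have w2E : w ^+ 2 / 128 = x ^+ 2 / 32.
  by rewrite -[w ^+ 2]real_normK ?num_real// wE; lra.
have m0 : (0 : R) < m%:R by rewrite ltr0n.
have m2 : (2 : R) <= m%:R by rewrite ler_nat.
rewrite -[m%:R * _ / _]mulrA w2E.
set D := 1 + _; have D0 : 0 < D by rewrite /D; have := sqr_ge0 x; nra.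
set e : R := Num.sqrt (_ / _); have e0 : 0 <= e := sqrtr_ge0 _.
have e2 : e ^+ 2 = 3 * c / n.*2.+2%:R.
  by rewrite sqr_sqrtr// divr_ge0// mulr_ge0// ltW.
(* As [|w| = 2 x], the factor [|w| ^- m] splits into [2 ^- m * x ^- m]; [P] and [1/sqrt (2 pi)] are
   bounded by [1]. [key] is what remains after clearing denominators. *)
suff key : h * D <= (e + 2 * 22 ^+ 2 / m%:R) * x ^+ m.
  apply: (@le_trans _ _ (2 ^- m * (x ^- m * h))).
    rewrite wE exprMn invfM -!mulrA.
    apply: ler_wpM2l; first by rewrite invr_ge0 exprn_ge0.
    apply: ler_wpM2l; first by rewrite invr_ge0 exprn_ge0// ltW.
    rewrite mulrCA ler_piMr// mulr_ile1 ?invr_ge0 ?sqrtr_ge0//.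
    by rewrite invf_le1 ?sqrt2pi_ge1//; exact: lt_le_trans sqrt2pi_ge1.
  rewrite -mulrA; apply: ler_wpM2l; first by rewrite invr_ge0 exprn_ge0.
  by rewrite ler_pdivlMr// -(mulrA _ h) ler_pdivrMl ?exprn_gt0// [leRHS]mulrC.
have xm0 : 0 <= x ^+ m by rewrite exprn_ge0// ltW.
have [x1|x1] := leP x (11 / 10).
  have x011 : 0 <= x <= 11 / 10 by rewrite ltW.
  have s0 : 0 <= sin x by rewrite sin_ge0_pi//; have := pi_ge2 R; lra.
  have hle : h <= e * sin x ^+ m.
    rewrite -ler_sqr ?nnegrE ?mulr_ge0 ?exprn_ge0// hE exprMn e2 -exprM muln2.
    rewrite [3 * c]mulrC -!mulrA ler_pM2l// [_^-1 * _]mulrC.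
    exact: sinint_le_sin_pow.
  have sD : sin x ^+ m * D <= x ^+ m.
    have b : D <= (1 + x ^+ 2 / 32) ^+ m.
      by apply: bernoulli_le; have := sqr_ge0 x; lra.
    apply: (@le_trans _ _ (sin x ^+ m * (1 + x ^+ 2 / 32) ^+ m)).
      by rewrite ler_wpM2l ?exprn_ge0.
    rewrite -exprMn lerXn2r ?nnegrE ?(ltW x0) ?sin_mul_le// mulr_ge0//.
    by have := sqr_ge0 x; lra.
  apply: (@le_trans _ _ (e * x ^+ m)).
    apply: (@le_trans _ _ (e * sin x ^+ m * D)); first by rewrite ler_wpM2r// ltW.
    by rewrite -mulrA ler_wpM2l.
  by rewrite ler_wpM2r// lerDl divr_ge0.
(* For large [x] only [h <= 1] is kept. In [2 * 22 ^+ 2] the square is [4 * 121], cancelling the [4]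
   of [m^2/4] and the [121] of [x <= 11 (x - 1)]; this leaves [2 m x^2], which exceeds [D]. *)
apply: (@le_trans _ _ D); first by rewrite ler_piMl// ltW.
apply: (@le_trans _ _ (2 * 22 ^+ 2 / m%:R * x ^+ m)); last first.
  by rewrite ler_wpM2r// lerDr.
have xq : m%:R * (m%:R - 1) / 2 * (x - 1) ^+ 2 <= x ^+ m.
  have := quadratic_le_exp (x - 1) m; rewrite (addrC 1) subrK; apply; lra.
(* [x <= 11 (x - 1)] *)
have xx : x ^+ 2 / 121 <= (x - 1) ^+ 2 by nra.
have xq2 : m%:R ^+ 2 / 4 * (x ^+ 2 / 121) <= x ^+ m.
  apply: le_trans xq; apply: ler_pM; rewrite ?divr_ge0 ?sqr_ge0//.
  by nra.
apply: (@le_trans _ _ (2 * 22 ^+ 2 / m%:R * (m%:R ^+ 2 / 4 * (x ^+ 2 / 121)))); last first.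
  by rewrite ler_wpM2l// divr_ge0.
have -> : 2 * 22 ^+ 2 / m%:R * (m%:R ^+ 2 / 4 * (x ^+ 2 / 121)) = 2 * m%:R * x ^+ 2.
  by field; rewrite gt_eqF.
rewrite /D; have : 1 <= x ^+ 2 by nra.
nra.
Qed.

(** For [x = w / 2], [m x^2 <= 1/4] and Bernoulli give [sin^m x >= x^m (1 - m x^2/2) >= 7/8 x^m].
    The infinite product is at least [3/4], and [7/8 * 3/4 >= 1/2]. *)
Lemma fourier_primitive_lb {R : realType} (n : nat) (H psi g : R -> R[i])
    (w : R) : daubechies_mask n.+1 H ->
  daubechies_wavelet H psi -> is_fourier_primitive n.+1%:Z psi g ->
  0 < w -> n.+1%:R * w ^+ 2 <= 1 ->
  2 ^- n.+1 * Num.sqrt (daub_c R n.+1 / n.*2.+2%:R) *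
    ((Num.sqrt (2 * pi))^-1 / 2) <= cmod (fourier g w).
Proof.
move=> dH dpsi dg w0 mw.
rewrite (cmod_fourier_primitive n.+1 H psi g w dpsi dg) ?gt_eqF//.
set m := n.+1; set c := daub_c _ _; set P := cmod (infprod _).
have c0 : 0 < c := daub_c_gt0 n.
have m1 : (1 : R) <= m%:R by rewrite (ler_nat _ 1).
rewrite -/m in mw.
have w1 : w <= 1 by rewrite leNgt; apply/negP => w1; nra.
have P34 : 3 / 4 <= P by apply: mask_infprod_ge dH _; rewrite w1 ltW.
set h := cmod (H _).
have h0 : 0 <= h := cmod_ge0 _.
have hE : h ^+ 2 = c * sinint n `|w / 2| := mask_sqrDpi n H (w / 2) dH.
pose x := w / 2; have x0 : 0 < x by rewrite divr_gt0.
rewrite ger0_norm -/x ?ltW// in hE.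
rewrite (gtr0_norm w0); have -> : w = 2 * x by rewrite /x; lra.
have mx : m%:R * x ^+ 2 <= 1 / 4 by rewrite /x exprMn; lra.
have xpi : 0 <= x <= pi by have := pi_ge2 R; rewrite /x; lra.
set s := (Num.sqrt (2 * pi))^-1.
have s0 : 0 <= s by rewrite invr_ge0 sqrtr_ge0.
set e := Num.sqrt _; have e0 : 0 <= e := sqrtr_ge0 _.
have e2 : e ^+ 2 = c / n.*2.+2%:R.
  by rewrite sqr_sqrtr// divr_ge0// ltW.
have hle : e * sin x ^+ m <= h.
  have s0' : 0 <= sin x by rewrite sin_ge0_pi.
  rewrite -ler_sqr ?nnegrE ?mulr_ge0 ?exprn_ge0// hE exprMn e2 -exprM muln2.
  rewrite -!mulrA ler_pM2l// [_^-1 * _]mulrC.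
  exact: sinint_ge_sin_pow.
have sx : 7 / 8 * x ^+ m <= sin x ^+ m.
  apply: (@le_trans _ _ ((x * (1 - x ^+ 2 / 2)) ^+ m)); last first.
    rewrite lerXn2r ?nnegrE ?sin_ge_cubic ?sin_ge0_pi// mulr_ge0 ?ltW//.
    by rewrite /x; nra.
  rewrite [leRHS]exprMn [leLHS]mulrC.
  apply: ler_wpM2l; first by rewrite exprn_ge0// ltW.
  apply: le_trans (bernoulli_le (- (x ^+ 2 / 2)) m _); first lra.
  by rewrite /x; nra.
have hx : 7 / 8 * e <= x ^- m * h.
  rewrite ler_pdivlMl ?exprn_gt0//; apply: le_trans hle.
  by have := ler_wpM2l e0 sx; lra.
rewrite exprMn invfM -!mulrA; apply: ler_wpM2l; first by rewrite invr_ge0 exprn_ge0.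
rewrite [leRHS](_ : _ = s * ((x ^- m * h) * P)); last by ring.
rewrite mulrCA; apply: ler_wpM2l => //.
apply: (@le_trans _ _ ((7 / 8 * e) * (3 / 4))); first lra.
by apply: ler_pM => //; rewrite mulr_ge0.
Qed.

(** * From pointwise bounds to norms *)

(* Comparison of the defining suprema; unlike [ge0_le_integral], it needs no
   measurability. *)
Lemma le_ge0_integral {d} {T : measurableType d} {R : realType}
    (mu : {measure set T -> \bar R}) (f g : T -> \bar R) :
  (forall x, 0 <= f x)%E -> (forall x, f x <= g x)%E ->
  (\int[mu]_x f x <= \int[mu]_x g x)%E.
Proof.
move=> f0 fg; have g0 x : (0 <= g x)%E by apply: le_trans (fg x).
rewrite !ge0_integralTE//; apply: ereal_sup_le => _ [h hf <-].
by exists h => // x; apply: le_trans (fg x).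
Qed.

Lemma continuous_oneDsqrV_scale {R : realType} (a : R) :
  continuous (fun x => (1 + (a * x) ^+ 2)^-1).
Proof.
move=> x; apply: (@continuous_comp _ _ _ ( *%R a) (fun y => (oneDsqr y)^-1)).
  exact: mulrl_continuous.
exact: continuous_oneDsqrV.
Qed.

Lemma integral_oneDsqrV_scale {R : realType} (a : R) : 0 < a ->
  (\int[lebesgue_measure]_x ((1 + (a * x) ^+ 2)^-1)%:E = (pi / a)%:E)%E.
Proof.
move=> a0; pose f (x : R) := (1 + (a * x) ^+ 2)^-1.
have f0 x : 0 <= f x by rewrite invr_ge0 addr_ge0// sqr_ge0.
have cf : continuous f := continuous_oneDsqrV_scale a.
rewrite (@ge0_symfun_integralT _ f)//; last first.
  by move=> x; rewrite /f/= mulrN sqrrN.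
have -> : [set x : R | 0 <= x] = `[0, +oo[%classic.
  by apply/seteqP; split => x; rewrite /= in_itv/= andbT.
have dF (x : R) : is_derive x 1 (fun y => atan (a * y) / a) (f x).
  have dx : is_derive x 1 (fun y => a * y) a by apply: is_derive_eq; rewrite /GRing.scale/= mulr1.
  have dc := is_deriveZ a^-1
    (@is_derive1_comp R atan (fun y => a * y) x _ _
      (is_derive1_atan (a * x)) dx).
  have -> : (fun y => atan (a * y) / a) = a^-1 \*: (atan \o (fun y => a * y)).
    by apply/funext => y /=; exact: mulrC.
  apply: (@is_derive_eq _ _ _ _ _ _ _ _ dc).
  by rewrite /GRing.scale/= mulrC mulfK ?gt_eqF.
rewrite (@ge0_continuous_FTC2y _ f (fun y => atan (a * y) / a) 0 (pi / 2 / a)).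
- rewrite mulr0 atan0 mul0r sube0 -EFinM; congr EFin; lra.
- by move=> x _.
- exact: continuous_subspaceT.
- apply: cvgMr_tmp.
  have : (fun y => a * y) x @[x --> +oo] --> +oo by apply: gt0_cvgMry.
  by move=> /cvg_comp; apply; exact: cvgy_atan.
- by move=> x _; case: (dF x).
- by apply: cvg_at_right_filter; exact: is_derive_continuous dF 0.
- by move=> x _; rewrite derive1E; case: (dF x).
Qed.

Lemma LnormEFin {R : realType} (p : R) (f : R -> R) : (forall x, 0 <= f x) ->
  ('N[@lebesgue_measure R]_(p%:E) [(fun w => (f w)%:E)] =
   (\int[lebesgue_measure]_w ((f w) `^ p)%:E) `^ p^-1)%E.
Proof.
move=> f0; rewrite unlock /=; congr (_ `^ _)%E.
by apply: eq_integral => x _; rewrite ger0_norm// poweR_EFin.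
Qed.

(** As [1/(1 + (a w)^2)] lies in []0, 1]] and [p > 1], its [p]-th power is at most itself, and its
    integral is explicit. *)
Lemma Lnorm_le_cauchy {R : realType} (p a B : R) (f : R -> R) :
  1 < p -> 0 < a -> 0 <= B -> (forall w, 0 <= f w) ->
  (forall w : R, w != 0 -> f w <= B / (1 + (a * w) ^+ 2)) ->
  ('N[@lebesgue_measure R]_(p%:E) [(fun w => (f w)%:E)] <=
   (B * (pi / a) `^ p^-1)%:E)%E.
Proof.
move=> p1 a0 B0 f0 fB; rewrite LnormEFin//.
have p0 : 0 < p by lra.
have -> : B * (pi / a) `^ p^-1 = (B `^ p * (pi / a)) `^ p^-1.
  rewrite [RHS]powRM ?powR_ge0 ?divr_ge0 ?pi_ge0 ?(ltW a0)//.
  by rewrite -powRrM mulfV ?gt_eqF// powRr1.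
rewrite -poweR_EFin; apply: gt0_ler_poweR; rewrite ?invr_ge0 ?(ltW p0)//.
- by rewrite in_itv/= leey andbT integral_ge0// => x _; rewrite lee_fin powR_ge0.
- by rewrite in_itv/= lee_fin leey andbT mulr_ge0 ?powR_ge0 ?divr_ge0 ?pi_ge0 ?(ltW a0).
pose g x := (1 + (a * x) ^+ 2)^-1.
have g0 x : 0 <= g x by rewrite invr_ge0 addr_ge0// sqr_ge0.
have g1 x : g x <= 1 by rewrite invf_le1 ?lerDl ?sqr_ge0// ltr_pwDl// sqr_ge0.
have mg : measurable_fun [set: R] g.
  apply: continuous_measurable_fun.
  exact: continuous_oneDsqrV_scale.
have mI : measurable_fun [set: R] (EFin \o (\1_[set (0 : R)] : R -> R)).
  have h : measurable_fun [set: R] (\1_[set (0 : R)] : R -> R).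
    exact: measurable_indic.
  exact/measurable_EFinP.
have mEg : measurable_fun [set: R] (EFin \o g) by exact/measurable_EFinP.
(* No upper bound on [f 0] is assumed; a multiple of the indicator of this null set makes the
   comparison hold everywhere. *)
apply: (@le_trans _ _ (\int[lebesgue_measure]_x ((B `^ p)%:E * (g x)%:E +
    (f 0 `^ p)%:E * (\1_[set (0 : R)] x)%:E))%E).
  apply: le_ge0_integral => x; first by rewrite lee_fin powR_ge0.
  rewrite -!EFinM -EFinD lee_fin.
  have [->|x0] := eqVneq x 0.
    by rewrite indicE mem_set// mulr1 lerDr mulr_ge0 ?powR_ge0.
  rewrite indicE memNset ?mulr0 ?addr0; last by move=> /= /eqP; exact/negP.
  apply: (@le_trans _ _ ((B * g x) `^ p)).
    by rewrite ge0_ler_powR ?nnegrE ?mulr_ge0 ?(ltW p0)// fB.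
  rewrite powRM// ler_wpM2l ?powR_ge0//.
  rewrite -[leRHS]powRr1//; apply: ger_powR; last exact: ltW.
  by rewrite g1 invr_gt0 ltr_pwDl// sqr_ge0.
rewrite ge0_integralD//=; last 4 first.
- by move=> x _; rewrite mule_ge0// lee_fin ?powR_ge0.
- by apply: measurable_funeM.
- by move=> x _; rewrite mule_ge0// lee_fin ?powR_ge0.
- exact: measurable_funeM.
rewrite !ge0_integralZl//; last 3 first.
- by rewrite lee_fin powR_ge0.
- by move=> x _; rewrite lee_fin.
- by rewrite lee_fin powR_ge0.
rewrite integral_indic// setIT.
rewrite [X in (_ + _ * X)%E](_ : _ = 0%E); last exact: lebesgue_measure_set1.
rewrite mule0 adde0.
by rewrite integral_oneDsqrV_scale.
Qed.

Lemma Lnorm_ge_interval {R : realType} (p b d : R) (f : R -> R) :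
  0 < p -> 0 < d -> 0 <= b -> (forall w, 0 <= f w) ->
  (forall w, 0 < w <= d -> b <= f w) ->
  ((b * d `^ p^-1)%:E <=
   'N[@lebesgue_measure R]_(p%:E) [(fun w => (f w)%:E)])%E.
Proof.
move=> p0 d0 b0 f0 fb; rewrite LnormEFin//.
have -> : b * d `^ p^-1 = (b `^ p * d) `^ p^-1.
  rewrite [RHS]powRM ?powR_ge0 ?(ltW d0)//.
  by rewrite -powRrM mulfV ?gt_eqF// powRr1.
rewrite -poweR_EFin; apply: gt0_ler_poweR; rewrite ?invr_ge0 ?(ltW p0)//.
- by rewrite in_itv/= lee_fin leey andbT mulr_ge0 ?powR_ge0 ?(ltW d0).
- by rewrite in_itv/= leey andbT integral_ge0// => x _; rewrite lee_fin powR_ge0.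
have mI : measurable_fun [set: R] (EFin \o (\1_(`]0, d]%classic : set R) : R -> R)).
  have h : measurable_fun [set: R] (\1_(`]0, d]%classic : set R) : R -> R).
    exact: measurable_indic.
  exact/measurable_EFinP.
apply: (@le_trans _ _ (\int[lebesgue_measure]_x ((b `^ p)%:E *
    (\1_(`]0, d]%classic : set R) x)%:E))%E).
  rewrite ge0_integralZl//; last by rewrite lee_fin powR_ge0.
  rewrite integral_indic// setIT.
  rewrite [X in (_ <= _ * X)%E](_ : _ = d%:E) ?EFinM//.
  apply: (etrans (lebesgue_measure_itv `]0, d])).
  by rewrite /= lte_fin d0 sube0.
apply: le_ge0_integral => x; first by rewrite mule_ge0// lee_fin ?powR_ge0.
rewrite -EFinM lee_fin indicE.
have [xd|xd] := boolP (x \in _); last by rewrite mulr0 powR_ge0.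
rewrite mulr1 ge0_ler_powR ?nnegrE ?(ltW p0)// fb//.
by move: xd; rewrite inE/= in_itv.
Qed.

(** * Size of the norm and choice of [A] *)

Lemma powR_Vl {R : realType} (x r : R) : 0 < x -> x^-1 `^ r = (x `^ r)^-1.
Proof.
move=> x0; have xr0 : x `^ r != 0 by rewrite gt_eqF// powR_gt0.
apply: (mulIf xr0); rewrite -powRM ?invr_ge0 ?(ltW x0)//.
by rewrite mulVf ?gt_eqF// powR1 mulVf.
Qed.

Lemma Lnorm_fourier_primitive_ub {R : realType} (p : R) (n : nat)
    (H psi g : R -> R[i]) : 1 < p -> (0 < n)%N -> daubechies_mask n.+1 H ->
  daubechies_wavelet H psi -> is_fourier_primitive n.+1%:Z psi g ->
  ('N[@lebesgue_measure R]_(p%:E) [(fun w => (cmod (fourier g w))%:E)] <=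
   (2 ^- n.+1 *
    (Num.sqrt (3 * daub_c R n.+1 / n.*2.+2%:R) + 2 * 22 ^+ 2 / n.+1%:R) *
    ((pi * Num.sqrt 128) `^ p^-1 / Num.sqrt n.+1%:R `^ p^-1))%:E)%E.
Proof.
move=> p1 n0 dH dpsi dg.
have m0 : (0 : R) < n.+1%:R by rewrite ltr0n.
have s0 : 0 < Num.sqrt n.+1%:R :> R by rewrite sqrtr_gt0.
have t0 : 0 < Num.sqrt 128 :> R by rewrite sqrtr_gt0.
(* Chosen so that [(a * w) ^+ 2] is [m w^2/128]. *)
pose a : R := Num.sqrt n.+1%:R / Num.sqrt 128.
have a0 : 0 < a by rewrite divr_gt0.
rewrite -powR_Vl// -powRM ?mulr_ge0 ?invr_ge0 ?pi_ge0 ?(ltW t0) ?(ltW s0)//.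
have -> : pi * Num.sqrt 128 * (Num.sqrt n.+1%:R)^-1 = pi / a.
  by rewrite /a invf_div mulrA.
apply: Lnorm_le_cauchy => //; first by move=> w; exact: cmod_ge0.
move=> w w0; apply: le_trans (fourier_primitive_ub n H psi g w n0 dH dpsi dg w0) _.
rewrite exprMn /a expr_div_n !sqr_sqrtr ?ler0n//.
by rewrite (mulrAC n.+1%:R).
Qed.

Lemma Lnorm_fourier_primitive_lb {R : realType} (p : R) (n : nat)
    (H psi g : R -> R[i]) : 0 < p -> daubechies_mask n.+1 H ->
  daubechies_wavelet H psi -> is_fourier_primitive n.+1%:Z psi g ->
  ((2 ^- n.+1 * Num.sqrt (daub_c R n.+1 / n.*2.+2%:R) *
    ((Num.sqrt (2 * pi))^-1 / 2) / Num.sqrt n.+1%:R `^ p^-1)%:E <=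
  'N[@lebesgue_measure R]_(p%:E) [(fun w => (cmod (fourier g w))%:E)])%E.
Proof.
move=> p0 dH dpsi dg.
have m0 : (0 : R) < n.+1%:R by rewrite ltr0n.
have s0 : 0 < Num.sqrt n.+1%:R :> R by rewrite sqrtr_gt0.
(* The interval is []0, 1/sqrt m]], on which [m w^2 <= 1]. *)
rewrite -powR_Vl//; apply: Lnorm_ge_interval => //; first by move=> w; exact: cmod_ge0.
move=> w /andP[w0 w1]; apply: (fourier_primitive_lb n H psi g w dH dpsi dg w0).
have sw : Num.sqrt n.+1%:R * w <= 1 by rewrite -ler_pdivlMl// mulr1.
rewrite -[n.+1%:R]sqr_sqrtr ?ler0n// -exprMn.
by apply: exprn_ile1 => //; rewrite mulr_ge0// ltW.
Qed.

Lemma majorant_coef_small {R : realType} (d : R) : 0 < d ->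
  exists N : nat, forall n, (N <= n)%N ->
  Num.sqrt (3 * daub_c R n.+1 / n.*2.+2%:R) + 2 * 22 ^+ 2 / n.+1%:R <= d.
Proof.
move=> d0.
have d2 : 0 < d ^+ 2 by rewrite exprn_gt0.
(* Each summand is to be at most [d / 2]. By [c_m <= sqrt (2m)] the first is, once
   [3/sqrt (2m) <= d^2/4], that is [sqrt (2m) >= 12/d^2]; the second is, once [m >= 44^2/d]. *)
pose T := (12 / d ^+ 2) ^+ 2 + 44 ^+ 2 / d.
have [N _ hN] := nbhs_infty_ger T.
exists N => n /hN /=; rewrite /T => Tn.
have m0 : (0 : R) < n.+1%:R by rewrite ltr0n.
have nm : n%:R <= n.+1%:R :> R by rewrite ler_nat.
have mE : n.*2.+2%:R = n.+1%:R * 2 :> R by rewrite -natrM muln2 doubleS.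
have T1 : (12 / d ^+ 2) ^+ 2 <= n.*2.+2%:R.
  have : 0 <= 44 ^+ 2 / d by rewrite divr_ge0// ltW.
  by rewrite mE; lra.
have T2 : 44 ^+ 2 / d <= n.+1%:R.
  have := sqr_ge0 (12 / d ^+ 2).
  lra.
have h2 : 2 * 22 ^+ 2 / n.+1%:R <= d / 2.
  rewrite ler_pdivrMr//; rewrite ler_pdivrMr// in T2; lra.
have q0 : 0 < Num.sqrt n.*2.+2%:R :> R by rewrite sqrtr_gt0.
have q2 : Num.sqrt n.*2.+2%:R ^+ 2 = n.*2.+2%:R :> R by rewrite sqr_sqrtr.
have qd : 12 / d ^+ 2 <= Num.sqrt n.*2.+2%:R.
  by rewrite -ler_sqr ?nnegrE ?divr_ge0 ?(ltW d2) ?(ltW q0)// q2.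
have h1 : Num.sqrt (3 * daub_c R n.+1 / n.*2.+2%:R) <= d / 2.
  have dd : 0 <= d / 2 by rewrite divr_ge0// ltW.
  rewrite -[leRHS]ger0_norm// -sqrtr_sqr; apply: ler_wsqrtr.
  apply: (@le_trans _ _ (3 / Num.sqrt n.*2.+2%:R)).
    set s := Num.sqrt _ in q0 q2 *.
    rewrite -q2 expr2 invfM mulrA ler_wpM2r ?invr_ge0 ?(ltW q0)//.
    by rewrite ler_pdivrMr// ler_wpM2l// daub_c_le_sqrt.
  rewrite ler_pdivrMr//; move: qd; rewrite ler_pdivrMr// => qd.
  by rewrite expr_div_n; lra.
by rewrite [leRHS]splitr lerD.
Qed.

Theorem theorem3 (R : realType) (p : R) (hp : 1 < p)
    (H psi psim : nat -> R -> R[i])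
    (hH : forall m, (0 < m)%N -> daubechies_mask m (H m))
    (hpsi : forall m, (0 < m)%N -> daubechies_wavelet (H m) (psi m))
    (hpsim : forall m, (0 < m)%N ->
       is_fourier_primitive m%:Z (psi m) (psim m)) :
  exists (C : R) (A e : nat -> R),
    [/\ 0 < C,
        forall m, (0 < m)%N ->
          Num.sqrt (daub_c R m / (2 * m%:R)) <= A m <= Num.sqrt (1 / 2),
        e =O_\oo (fun m : nat => (m%:R : R) `^ (- (1 / 2)))
      & \forall m \near \oo,
          'N[@lebesgue_measure R]_(p%:E)
            [(fun w : R => (cmod (fourier (psim m) w))%:E)]%E =
          (C * (2 `^ (1 / p) / Num.sqrt (2 * pi)) *
           (2 ^- m * A m / Num.sqrt (m%:R * p / 2) `^ (1 / p)) *
           (1 + e m))%:E].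
Proof.
have p0 : 0 < p by lra.
set L := fun m => 'N[@lebesgue_measure R]_(p%:E)
            [(fun w : R => (cmod (fourier (psim m) w))%:E)]%E.
pose lo m : R := Num.sqrt (daub_c R m / (2 * m%:R)).
(* Splitting [sqrt (m p/2)^(1/p)] into [sqrt m ^(1/p)] and [q] isolates the dependence on [m]. *)
pose q : R := Num.sqrt (p / 2) `^ p^-1.
have q0 : 0 < q by rewrite powR_gt0// sqrtr_gt0 divr_gt0.
pose b : R := (Num.sqrt (2 * pi))^-1 / 2.
have s2pi : 0 < Num.sqrt (2 * pi) :> R by apply: lt_le_trans sqrt2pi_ge1.
have b0 : 0 < b by rewrite divr_gt0// invr_gt0.
pose G : R := 2 `^ p^-1 / Num.sqrt (2 * pi) / q.
have G0 : 0 < G by rewrite !divr_gt0// powR_gt0.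
pose K m : R := 2 ^- m * G / Num.sqrt m%:R `^ p^-1.
have K0 n : 0 < K n.+1.
  rewrite /K divr_gt0 ?powR_gt0 ?sqrtr_gt0 ?ltr0n//.
  by rewrite mulr_gt0// invr_gt0 exprn_gt0.
(* With this [C] the lower bound for the norm is exactly [C * K m * lo m]. *)
pose C := b / G; have C0 : 0 < C by rewrite divr_gt0.
pose M : R := (pi * Num.sqrt 128) `^ p^-1 / G.
have M0 : 0 < M by rewrite divr_gt0// powR_gt0// mulr_gt0 ?pi_gt0// sqrtr_gt0.
have hi0 : 0 < Num.sqrt (1 / 2) :> R by rewrite sqrtr_gt0.
have lohi n : lo n.+1 <= Num.sqrt (1 / 2).
  rewrite ler_wsqrtr// invfM mulrCA -[leRHS]mulr1 div1r ler_wpM2l//.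
  by rewrite ler_pdivrMr ?ltr0n// mul1r daub_c_le.
(* The upper bound for the norm is [K m * M] times the coefficient in [majorant_coef_small]; once
   that coefficient is below this threshold, the norm is at most [C * K m * sqrt (1/2)]. *)
have d0 : 0 < Num.sqrt (1 / 2) * C / M by apply: divr_gt0 => //; exact: mulr_gt0.
have [N hN] := majorant_coef_small _ d0.
pose t m := fine (L m) / (C * K m).
(* The bounds on [A] must hold for every positive [m], the formula only eventually; [lo m] is an
   admissible value while [t m] is out of range. *)
pose A m := if lo m <= t m <= Num.sqrt (1 / 2) then t m else lo m.
exists C, A, (fun=> 0); split => //.
- move=> [//|n] _; rewrite /A -/(lo _); case: ifP => [->//|_].
  by rewrite lexx lohi.
- by apply/eqO_exP; exists 1 => //; apply: nearW => m; rewrite normr0 mul1r.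
(* The shift by two yields [m = n.+1] with [n > N], so that [n] is also positive, as the upper bound
   demands. *)
near=> m; have mN : (N.+2 <= m)%N by near: m; exact: nbhs_infty_ge.
have [n nN ->] : exists2 n, (N < n)%N & m = n.+1.
  by exists m.-1; rewrite ?(ltn_predK mN)// -ltnS (ltn_predK mN).
have n0 : (0 < n)%N by apply: leq_trans nN.
rewrite -/(L _) addr0 mulr1.
have ub := Lnorm_fourier_primitive_ub p n (H n.+1) (psi n.+1) (psim n.+1) hp n0
  (hH _ (ltn0Sn n)) (hpsi _ (ltn0Sn n)) (hpsim _ (ltn0Sn n)).
have lb := Lnorm_fourier_primitive_lb p n (H n.+1) (psi n.+1) (psim n.+1) p0
  (hH _ (ltn0Sn n)) (hpsi _ (ltn0Sn n)) (hpsim _ (ltn0Sn n)).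
rewrite -/(L _) in ub lb.
(* [fine] sends infinite values to [0]; the two finite bounds exclude them, so [t] is the true
   quotient. *)
have Lfin : (L n.+1) \is a fin_num.
  by rewrite fin_numE; apply/andP; split; apply/eqP => LE; move: ub lb; rewrite LE.
rewrite -(fineK Lfin) !lee_fin in ub lb *.
pose S : R := Num.sqrt n.+1%:R `^ p^-1.
have S0 : 0 < S by rewrite powR_gt0// sqrtr_gt0 ltr0n.
have e0 : 0 < 2 ^+ n.+1 :> R by rewrite exprn_gt0.
have CK0 : 0 < C * K n.+1 by rewrite mulr_gt0.
have lt : lo n.+1 <= t n.+1.
  rewrite ler_pdivlMr//; apply: le_trans lb.
  have -> : lo n.+1 = Num.sqrt (daub_c R n.+1 / n.*2.+2%:R).
    by rewrite /lo -natrM mul2n.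
  rewrite le_eqVlt; apply/orP; left; apply/eqP.
  rewrite /C /K -/S -/b; field.
  by rewrite !gt_eqF.
have th : t n.+1 <= Num.sqrt (1 / 2).
  rewrite ler_pdivrMr//; apply: (le_trans ub).
  have := hN n (ltnW nN); set E := (X in X <= _); rewrite ler_pdivlMr// => hE.
  have -> : (pi * Num.sqrt 128) `^ p^-1 = M * G by rewrite /M divfK ?gt_eqF.
  rewrite -/S -/E.
  rewrite [leLHS](_ : _ = 2 ^- n.+1 * (G / S) * (E * M)); last first.
    by field; rewrite !gt_eqF.
  rewrite [leRHS](_ : _ = 2 ^- n.+1 * (G / S) * (Num.sqrt (1 / 2) * C)); last first.
    by rewrite /K -/S; field; rewrite !gt_eqF.
  by rewrite ler_wpM2l// mulr_ge0 ?divr_ge0 ?invr_ge0 ?ltW.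
have SE : Num.sqrt (n.+1%:R * p / 2) `^ p^-1 = S * q.
  by rewrite -mulrA sqrtrM ?ler0n// powRM ?sqrtr_ge0.
rewrite /A lt th/= !div1r SE; congr EFin.
rewrite /t /K -/S /G; field.
rewrite !gt_eqF//.
Unshelve. all: by end_near. Qed.
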